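(* Let $X$ be a super-reflexive Banach space. There exist a constant $C_r>0$ and $w\in(0,1/2]$ such that the sequence $r_k(X)=C_r k^{-w}$ has the following property: for every natural number $n\ge 1$, every $n$-point subset $P$ of the unit ball $\mathbf{B}$ and every natural number $k\ge 1$, there exists a point $x\in X$ such that every closed half-space containing the ball $r_k(X)\mathbf{B}+x$ contains at least $\frac{n}{k}$ points of $P$.
   Context: Banach spaces are real. $\mathbf{B}=\{x\in X:\|x\|\le 1\}$ is the unit ball centered at the origin. A closed half-space is a set $\{y\in X: f(y)\le c\}$ with $f$ a non-zero continuous linear functional and $c\in\mathbb{R}$. A Banach space $X$ is super-reflexive if every Banach space finitely representable in $X$ is reflexive; equivalently, $X$ admits an equivalent uniformly convex norm. *)

(* Defs.v *)
From HB Require Import structures.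
From mathcomp Require Import all_boot all_order all_algebra finmap.
From mathcomp Require Import all_classical all_reals all_analysis.

Set Implicit Arguments.
Unset Strict Implicit.
Unset Printing Implicit Defensive.

Import Order.TTheory GRing.Theory Num.Theory.
Import numFieldNormedType.Exports.

Local Open Scope classical_set_scope.
Local Open Scope ring_scope.

Definition unit_ball (R : realType) (X : normedModType R) : set X :=
  [set x | `|x| <= 1].

Arguments unit_ball {R} X.

Definition dual (R : realType) (X : normedModType R) : set (X -> R) :=
  [set f : X -> R | scalar f /\ continuous f].

Arguments dual {R} X.

Definition dual_norm (R : realType) (X : normedModType R) (f : X -> R) : R :=
  sup [set `|f x| | x in unit_ball X].

(* [Phi] is an element of the bidual of [X].  It is given as a function on all
   maps [X -> R], but only its values on [dual X] are constrained. *)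
Definition bidual_elt (R : realType) (X : normedModType R)
    (Phi : (X -> R) -> R) : Prop :=
  (forall (a : R) (f g : X -> R), dual X f -> dual X g ->
     Phi (fun x => a * f x + g x) = a * Phi f + Phi g) /\
  (exists M : R, forall f : X -> R, dual X f -> `|Phi f| <= M * dual_norm f).

Definition reflexive_space (R : realType) (X : normedModType R) : Prop :=
  forall Phi : (X -> R) -> R, bidual_elt Phi ->
    exists x : X, forall f : X -> R, dual X f -> Phi f = f x.

Definition fin_dim_subspace (R : realType) (X : normedModType R)
    (E : set X) : Prop :=
  exists (n : nat) (e : 'I_n -> X),
    E = [set x | exists a : 'I_n -> R, x = \sum_(i < n) a i *: e i].

(* James's definition: every finite-dimensional subspace [E] of [Y] embeds
   linearly into [X], with distortion arbitrarily close to 1.  The values of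
   [T] outside [E] are irrelevant. *)
Definition finitely_representable (R : realType) (Y X : normedModType R) :
    Prop :=
  forall E : set Y, fin_dim_subspace E -> forall lambda : R, 1 < lambda ->
    exists T : Y -> X,
      (forall (a : R) (u v : Y), E u -> E v ->
         T (a *: u + v) = a *: T u + T v) /\
      (forall y : Y, E y -> lambda^-1 * `|y| <= `|T y| <= lambda * `|y|).

Definition super_reflexive (R : realType) (X : completeNormedModType R) :
    Prop :=
  forall Y : completeNormedModType R,
    finitely_representable Y X -> reflexive_space Y.

Definition closed_halfspace (R : realType) (X : normedModType R)
    (H : set X) : Prop :=
  exists (f : X -> R) (c : R),
    [/\ dual X f, (exists x, f x != 0) & H = [set y | f y <= c]].

(* Main.v *)
Require Import Defs.
From HB Require Import structures.
From mathcomp Require Import all_boot all_order all_algebra finmap.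
From mathcomp Require Import all_classical all_reals all_analysis.
From mathcomp Require Import ring lra.

Import Order.TTheory GRing.Theory Num.Theory.
Import numFieldNormedType.Exports.

Local Open Scope classical_set_scope.
Local Open Scope ring_scope.

(** The centroid [x] of [P] is a suitable point, with [w = 1 / 2] and [C = 4].
    Let a half-space [f <= c] contain the ball of radius [r] about [x], and put
    [g p = f p - f x] and [d = c - f x].  The values of [g] on [P] have sum [0].
    As [P] and [x] lie in the unit ball, each [x - p] has norm at most [2], so
    [(r / 2) *: (x - p) + x] is in the ball and hence in the half-space:
    [g p >= - (2 / r) * d].  The points of [P] outside the half-space have
    [g p > d], and each point inside can compensate at most [2 / r] of those.
    This reverse Markov inequality, [card_le_card_sublevel], gives
    [n <= (1 + 2 / r) * m], where [m] is the number of points of [P] in the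
    half-space.  For [k >= 2] and [r = 4 / sqrt k] the factor
    [1 + sqrt k / 2] is at most [k].  For [k = 1] the ball has radius [4] and
    contains the whole unit ball, therefore all of [P]. *)

Lemma natr_cardfs (R : nzSemiRingType) (T : choiceType) (A : {fset T}) :
  #|` A|%:R = \sum_(p <- A) (1 : R).
Proof. by rewrite big_const_seq count_predT iter_addr_0. Qed.

(** Reverse Markov inequality: if [d > 0], each term is at least [- s * d] when
    [g p <= d] and at least [d] otherwise, so a nonpositive sum bounds the
    number of large terms by [s] times the number of the others.  If [d = 0],
    all terms are nonnegative, hence zero, and every point is counted. *)
Lemma card_le_card_sublevel (R : realFieldType) (T : choiceType)
    (P : {fset T}) (g : T -> R) (d s : R) :
  0 <= s -> 0 <= d -> \sum_(p <- P) g p <= 0 ->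
  (forall p, p \in P -> - (s * d) <= g p) ->
  #|` P|%:R <= (1 + s) * #|` [fset p in P | g p <= d]%fset|%:R.
Proof.
move=> s0 d0 sumg0 gge.
have subE : #|` [fset p in P | g p <= d]%fset|%:R
    = \sum_(p <- P) (g p <= d)%R%:R :> R.
  rewrite natr_cardfs big_fset /= big_mkcond /=.
  by apply: eq_bigr => p _; case: ifP.
move: d0; rewrite le_eqVlt => /predU1P[d0|d0].
- have g0 p : p \in P -> 0 <= g p by move=> /gge; rewrite -d0 mulr0 oppr0.
  have allP p : p \in P -> g p <= d.
    move=> pP; rewrite -d0; apply: le_trans sumg0.
    rewrite (big_fsetD1 p) //= lerDl big_seq; apply: sumr_ge0 => q.
    by rewrite in_fsetD1 => /andP[_ /g0].
  have -> : [fset p in P | g p <= d]%fset = P.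
    apply/fsetP => p; rewrite !inE /=.
    by case: (boolP (p \in P)) => //= /allP ->.
  by rewrite ler_peMl // lerDl.
- rewrite -subr_le0 -(pmulr_rle0 _ d0); apply: le_trans sumg0.
  rewrite subE natr_cardfs mulr_sumr -sumrB mulr_sumr.
  rewrite [leLHS]big_seq [leRHS]big_seq; apply: ler_sum => p pP.
  have := gge _ pP.
  by have [_|/ltW] := leP (g p) d; rewrite /= ?mulr1 ?mulr0 => *; nra.
Qed.

Lemma norm_centroid_le1 (R : realType) (X : normedModType R) (P : {fset X}) :
  [set` P] `<=` unit_ball X -> `|#|` P|%:R^-1 *: \sum_(p <- P) p| <= 1.
Proof.
move=> PB; have [->|P0] := eqVneq P fset0.
  by rewrite cardfs0 invr0 scale0r normr0.
rewrite normrZ normfV normr_nat ler_pdivrMl ?ltr0n ?cardfs_gt0// mulr1.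
apply: le_trans (ler_norm_sum _ _ _) _.
by rewrite natr_cardfs [leLHS]big_seq [leRHS]big_seq; apply: ler_sum => p /PB.
Qed.

Lemma sum_sub_centroid (R : realType) (X : normedModType R) (P : {fset X})
    (f : {scalar X}) :
  \sum_(p <- P) (f p - f (#|` P|%:R^-1 *: \sum_(q <- P) q)) = 0.
Proof.
have [->|P0] := eqVneq P fset0; first by rewrite big_seq_fset0.
rewrite sumrB big_const_seq count_predT iter_addr_0.
rewrite [f (_ *: _)]linearZ /= linear_sum /= -mulrnAl -[_^-1 *+ _]mulr_natr.
by rewrite mulVf ?mul1r ?subrr// pnatr_eq0 cardfs_eq0.
Qed.

Theorem theorem1p4 (R : realType) (X : completeNormedModType R)
    (X_super_reflexive : super_reflexive X) :
  exists (C w : R), [/\ 0 < C, 0 < w, w <= 1 / 2 &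
    forall (n : nat), (1 <= n)%N ->
    forall P : {fset X}, #|` P| = n -> [set` P] `<=` unit_ball X ->
    forall (k : nat), (1 <= k)%N ->
    exists x : X, forall H : set X, closed_halfspace H ->
      [set C * k%:R `^ (- w) *: b + x | b in unit_ball X] `<=` H ->
      n%:R / k%:R <= #|` [fset p in P | p \in H]%fset|%:R :> R].
Proof.
exists 4, (1 / 2); split; [lra|lra|lra|] => n n0 P cardP PB k k0.
exists (n%:R^-1 *: \sum_(p <- P) p) => H [f [c [[flin _] _ HE]]].
have [fL fE] : exists fL : {scalar X}, f = fL.
  pose flinear := GRing.isLinear.Build _ _ _ _ f flin.
  by exists (HB.pack_for {scalar X} f flinear).
subst f.
set x := _ *: _; set r := 4 * _ => ballH.
have x1 : `|x| <= 1 by rewrite /x -cardP norm_centroid_le1.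
have k0R : (0 : R) < k%:R by rewrite ltr0n.
have sk0 : 0 < Num.sqrt (k%:R : R) by rewrite sqrtr_gt0.
have rE : r = 4 / Num.sqrt k%:R.
  by rewrite /r div1r powRN powR12_sqrt // ler0n.
have fball a y z : `|a| * `|y - z| <= 1 -> r * (a * (fL y - fL z)) + fL x <= c.
  rewrite -normrZ => ayz1; have : H (r *: (a *: (y - z)) + x).
    by apply: ballH; exists (a *: (y - z)).
  by rewrite HE /= linearD linearZ [fL (_ *: _)]linearZ [fL (_ - _)]linearB.
have normPx p : p \in P -> `|p - x| <= 2.
  move=> /PB p1; apply: le_trans (ler_normB _ _) _.
  by rewrite -[2]/(1 + 1); apply: lerD.
have HP p : (p \in H) = (fL p - fL x <= c - fL x).
  by rewrite lerD2r; apply/idP/idP; rewrite inE HE.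
have -> : [fset p in P | p \in H]%fset
    = [fset p in P | fL p - fL x <= c - fL x]%fset.
  by apply/fsetP => p; rewrite !inE /= HP.
have [k1|k2] := leqP k 1.
  (* Here [r = 4], so every point of [P] is in the ball about [x]. *)
  have kE : k = 1%N by apply/eqP; rewrite eqn_leq k1.
  have r4 : r = 4 by rewrite rE kE sqrtr1 divr1.
  have -> : [fset p in P | fL p - fL x <= c - fL x]%fset = P.
    apply/fsetP => p; rewrite !inE /=; case: (boolP (p \in P)) => //= pP.
    have := fball 4^-1 p x; rewrite r4 ger0_norm //.
    by have := normPx _ pP; lra.
  by rewrite kE divr1 cardP.
rewrite ler_pdivrMr // -cardP.
have s2 : 0 <= Num.sqrt (k%:R : R) / 2 by rewrite divr_ge0 // ltW.
apply: le_trans (card_le_card_sublevel _ _ P (fun p => fL p - fL x) (c - fL x)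
  (Num.sqrt k%:R / 2) s2 _ _ _) _.
- by have := fball 0 x x; rewrite normr0 mul0r; lra.
- by rewrite /x -cardP sum_sub_centroid.
- move=> p pP.
  have : r * (2^-1 * (fL x - fL p)) + fL x <= c.
    apply: fball; rewrite distrC ger0_norm //.
    by have := normPx _ pP; lra.
  have -> : r * (2^-1 * (fL x - fL p)) = (fL x - fL p) / (Num.sqrt k%:R / 2).
    by rewrite rE; field; rewrite gt_eqF.
  by rewrite -lerBrDr ler_pdivrMr ?divr_gt0 //; lra.
- rewrite mulrC; apply: ler_wpM2l; first exact: ler0n.
  (* With [t = sqrt k], the claim [1 + t / 2 <= t ^+ 2] follows from
     [t ^+ 2 >= 2]. *)
  have kk : Num.sqrt (k%:R : R) ^+ 2 = k%:R by rewrite sqr_sqrtr // ler0n.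
  have k2R : (2 : R) <= k%:R by rewrite ler_nat.
  nra.
Qed.
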